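(* Let $L/K$ be a degree $2$ Galois extension of fields with Galois group generated by $\sigma$. Assume that either $\mathrm{char}(K)=0$, or $\mathrm{char}(K)\ne 2$ and there is a pair $(w,\delta)$ such that $\delta\in(\Delta\cap(1-\Delta))\setminus\{0,1\}$, $w\in L\setminus K$, $w\sigma(w)=\delta$ and both $\delta$ and $1-\delta$ are squares in $K$. Let $n\ge 1$. A matrix $M\in M_{n,n}(L)$ is Hermitian (i.e. $M^\dagger=M$) if and only if $\mathrm{Num}(M)\subseteq K$.
   Context: $M_{n,n}(L)$ is the set of $n\times n$ matrices over $L$. For $M=(m_{ij})$, $M^\dagger:=(\sigma(m_{ji}))$ is the $\sigma$-conjugate transpose. For $u,v\in L^n$ set $\langle u,v\rangle:=\sum_{i=1}^n\sigma(u_i)v_i$. The numerical range of $M\in M_{n,n}(L)$ is $\mathrm{Num}(M):=\{\langle u,Mu\rangle \mid u\in L^n,\ \langle u,u\rangle=1\}\subseteq L$. $\Delta:=\{a\sigma(a)\mid a\in L\}\subseteq K$ and $1-\Delta:=\{1-s\mid s\in\Delta\}$. *)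

(* Defs.v *)
(* An extension L/K is given as L : splittingFieldType K; K is seen inside L as
   the subfield 1%VS (the image of K under k |-> k%:A). *)
From HB Require Import structures.
From mathcomp Require Import all_boot all_order all_algebra all_fingroup.
From mathcomp Require Import all_solvable all_field.

Set Implicit Arguments.
Unset Strict Implicit.
Unset Printing Implicit Defensive.

Import GRing.Theory.
Local Open Scope ring_scope.

Section SigmaForms.

Variables (L : fieldType) (sigma : L -> L).

Definition dagger (n : nat) (M : 'M[L]_n) : 'M[L]_n :=
  \matrix_(i, j) sigma (M j i).

Definition hermitian_mx (n : nat) (M : 'M[L]_n) : Prop := dagger M = M.

Definition herm (n : nat) (u v : 'cV[L]_n) : L :=
  \sum_(i < n) sigma (u i 0) * v i 0.

Definition num_range (n : nat) (M : 'M[L]_n) (z : L) : Prop :=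
  exists u : 'cV[L]_n, herm u u = 1 /\ z = herm u (M *m u).

Definition Delta (d : L) : Prop := exists a : L, d = a * sigma a.

Definition one_minus_Delta (d : L) : Prop := exists s : L, Delta s /\ d = 1 - s.

End SigmaForms.

Definition square_in_base (K : fieldType) (L : fieldExtType K) (d : L) : Prop :=
  exists k : K, d = (k ^+ 2)%:A.

(* Main.v *)
(* If Num(M) lies in K, then N = M - M^dagger satisfies <u, N u> = 0 on the
   unit sphere.  Basis vectors give N_ii = 0, and u = a e_i + b e_j with
   a sigma(a) + b sigma(b) = 1 shows that sigma(a) b N_ij lies in K.  A pair
   (a, b) = (h, k) of nonzero elements of K with h^2 + k^2 = 1 forces N_ij into
   K, and then a pair (w, k) with w outside K and w sigma(w) = h^2 forces
   N_ij = 0.  In characteristic 0 one takes (h, k) = (3/5, 4/5) and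
   w = (3/5) w0, where w0 is an element of norm 1 outside K. *)
Require Import Defs.
From HB Require Import structures.
From mathcomp Require Import all_boot all_order all_algebra all_fingroup.
From mathcomp Require Import all_solvable all_field.
From mathcomp Require Import ring.

Set Implicit Arguments.
Unset Strict Implicit.
Unset Printing Implicit Defensive.

Import GRing.Theory.
Local Open Scope ring_scope.

Section Involution.

Variables (L : fieldType) (sigma : {rmorphism L -> L}).
Hypothesis sigmaK : involutive sigma.

Lemma herm_conj n (u v : 'cV[L]_n) : sigma (herm sigma u v) = herm sigma v u.
Proof.
rewrite /herm rmorph_sum; apply: eq_bigr => i _.
by rewrite rmorphM sigmaK mulrC.
Qed.

Lemma herm_dagger n (M : 'M[L]_n) (u v : 'cV[L]_n) :
  herm sigma (M *m u) v = herm sigma u (dagger sigma M *m v).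
Proof.
rewrite /herm.
under eq_bigr => i _ do rewrite mxE rmorph_sum big_distrl.
rewrite exchange_big; apply: eq_bigr => j _ /=.
rewrite mxE big_distrr; apply: eq_bigr => i _ /=.
by rewrite mxE rmorphM mulrCA mulrA.
Qed.

Lemma herm_delta n (M : 'M[L]_n) (i j : 'I_n) :
  herm sigma (delta_mx i 0) (M *m delta_mx j 0) = M i j.
Proof.
rewrite -colE /herm (bigD1 i) //= big1 => [|k /negPf ki].
  by rewrite !mxE !eqxx rmorph1 mul1r addr0.
by rewrite !mxE ki rmorph0 mul0r.
Qed.

Lemma herm_comb n (M : 'M[L]_n) (u v : 'cV[L]_n) (a b : L) :
  herm sigma (a *: u + b *: v) (M *m (a *: u + b *: v)) =
    sigma a * a * herm sigma u (M *m u) + sigma a * b * herm sigma u (M *m v)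
    + sigma b * a * herm sigma v (M *m u)
    + sigma b * b * herm sigma v (M *m v).
Proof.
rewrite mulmxDr -!scalemxAr /herm !big_distrr -!big_split /=.
by apply: eq_bigr => i _; rewrite !mxE rmorphD !rmorphM; ring.
Qed.

(** Applying [sigma] swaps the arguments of the form, and moving [M] back across it turns [M] into
    its dagger, which is [M] again. *)
Lemma num_range_hermitian n (M : 'M[L]_n) z :
  hermitian_mx sigma M -> num_range sigma M z -> sigma z = z.
Proof. by move=> hM [u [_ ->]]; rewrite herm_conj herm_dagger hM. Qed.

(** The scalars [h], [k], [w] isolate what the two alternatives on the characteristic have to
    supply. *)
Lemma hermitian_num_range n (M : 'M[L]_n) (h k w : L) :
    sigma h = h -> sigma k = k -> h != 0 -> k != 0 -> h ^+ 2 + k ^+ 2 = 1 ->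
    w * sigma w = h ^+ 2 -> sigma w != w ->
    (forall z, num_range sigma M z -> sigma z = z) ->
  hermitian_mx sigma M.
Proof.
move=> sh sk h0 k0 hk1 ww sw hM.
have herm1 i j : herm sigma (delta_mx i 0 : 'cV[L]_n) (delta_mx j 0)
    = (i == j)%:R.
  by rewrite -[delta_mx j 0]mul1mx herm_delta mxE.
have diag i : sigma (M i i) = M i i.
  apply: hM; exists (delta_mx i 0).
  by rewrite herm1 eqxx herm_delta.
have cross i j a b : i != j -> a * sigma a + b * sigma b = 1 ->
    sigma (sigma a * b * (M i j - sigma (M j i)))
      = sigma a * b * (M i j - sigma (M j i)).
  move=> ij ab1.
  set u : 'cV[L]_n := a *: delta_mx i 0 + b *: delta_mx j 0.
  have u1 : herm sigma u u = 1.
    rewrite -[X in herm _ _ X]mul1mx herm_comb !mul1mx !herm1 !eqxx.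
    by rewrite [j == i]eq_sym (negPf ij) mulr1n mulr0n -[RHS]ab1; ring.
  (* The diagonal terms of the value at [u] are fixed by [sigma]; equating the sum of the two cross
     terms with its image and regrouping gives the claim. *)
  have := hM _ (ex_intro _ u (conj u1 erefl)).
  rewrite herm_comb !herm_delta !(rmorphD, rmorphM, rmorphN) /= !sigmaK !diag.
  move=> e; apply/eqP; rewrite -subr_eq0; apply/eqP.
  by move/eqP: e; rewrite -subr_eq0 => /eqP <-; ring.
apply/matrixP => i j; rewrite mxE.
have [<-|ij] := eqVneq i j; first exact: diag.
have [c0|c0] := eqVneq (M i j - sigma (M j i)) 0.
  by apply/esym/eqP; rewrite -subr_eq0 c0.
have sc : sigma (M i j - sigma (M j i)) = M i j - sigma (M j i).
  have := cross i j h k ij; rewrite sh sk -!expr2 => /(_ hk1).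
  by rewrite rmorphM rmorphM sh sk; apply: mulfI; rewrite mulf_neq0.
(* Cancelling the fixed nonzero factors [k] and [M i j - sigma (M j i)] would leave [w] fixed. *)
have := cross i j w k ij; rewrite sk ww -expr2 => /(_ hk1).
rewrite rmorphM sc => /(mulIf c0); rewrite rmorphM sk sigmaK => /(mulIf k0) e.
by rewrite -e eqxx in sw.
Qed.

(* Hilbert 90: [x / sigma x] has norm 1.  It is fixed only if it is [1] or [-1],
   so that one of [x = t] and [x = 1 + t] works whenever [t] is not fixed. *)
Lemma exists_norm1_not_fixed (t : L) :
    2%:R != 0 :> L -> sigma t != t ->
  exists2 w, w * sigma w = 1 & sigma w != w.
Proof.
move=> two0 st.
have quot x : x != 0 -> sigma x != x -> sigma x != - x ->
    exists2 w, w * sigma w = 1 & sigma w != w.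
  move=> x0 sx sxN; have sx0 : sigma x != 0 by rewrite fmorph_eq0.
  exists (x / sigma x).
    by rewrite fmorph_div sigmaK; field; rewrite x0 sx0.
  (* The quotient is fixed exactly when [sigma x] and [x] have equal squares. *)
  rewrite fmorph_div sigmaK eqr_div // -!expr2 eqf_sqr.
  by rewrite (negPf sx) (negPf sxN).
have t0 : t != 0 by apply: contraNneq st => ->; rewrite rmorph0.
have [stN|] := eqVneq (sigma t) (- t); last exact: quot.
have s1t : sigma (1 + t) = 1 - t by rewrite rmorphD rmorph1 stN.
apply: (quot (1 + t)).
- apply: contraNneq st => t1; have := s1t; rewrite t1 rmorph0 => /esym t2.
  have e2 : 2%:R = 0 :> L by rewrite -(addr0 0) -[X in X + _]t1 -t2; ring.
  by rewrite e2 eqxx in two0.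
- by rewrite s1t; apply: contraNneq st => /addrI tN; rewrite stN tN.
- rewrite s1t -subr_eq0 (_ : _ - _ = 2%:R) //; ring.
Qed.

End Involution.

Section QuadraticGalois.

Variables (K : fieldType) (L : splittingFieldType K) (sigma : gal_of {:L}).
Hypothesis hgal : galois 1%AS {:L}.
Hypothesis hsigma : 'Gal({:L} / 1%AS)%g = <[sigma]>%g.

(** The order of the generator [sigma] is that of the Galois group, hence the degree 2. *)
Lemma gal_generator_involutive : \dim {:L} = 2%N -> involutive sigma.
Proof.
move=> hdeg x.
have := galois_dim hgal; rewrite hsigma dimv1 divn1 hdeg => o2.
have := expg_order sigma; rewrite orderE -o2 expg2 => s2.
by have := galM sigma sigma (memvf x); rewrite s2 gal_id.
Qed.

(** The base is the fixed field of the group, and an element fixed by a generator is fixed by all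
    its powers. *)
Lemma mem_base_gal_fixed x : (x \in 1%VS) = (sigma x == x).
Proof.
have <- := galois_fixedField hgal; rewrite hsigma.
apply/(fixedFieldP (memvf x))/eqP => [|sx].
  by apply; exact: cycle_id.
move=> _ /cycleP[m ->]; elim: m => [|m IH]; first by rewrite expg0 gal_id.
by rewrite expgS galM ?memvf // sx.
Qed.

End QuadraticGalois.

Theorem proposition3 (K : fieldType) (L : splittingFieldType K)
  (sigma : gal_of {:L})
  (hdeg : \dim {:L} = 2%N)
  (hgal : galois 1%AS {:L})
  (hsigma : 'Gal({:L} / 1%AS)%g = <[sigma]>%g)
  (hK : [pchar K] =i pred0 \/
        2%N \notin [pchar K] /\
        exists w delta : L,
          (Delta sigma delta /\ one_minus_Delta sigma delta) /\
          (delta <> 0 /\ delta <> 1) /\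
          w \notin 1%VS /\
          w * sigma w = delta /\
          square_in_base delta /\ square_in_base (1 - delta))
  (n : nat) (hn : (1 <= n)%N) (M : 'M[L]_n) :
  hermitian_mx sigma M <-> (forall z : L, num_range sigma M z -> z \in 1%VS).

Proof.
have sK := gal_generator_involutive hgal hsigma hdeg.
have mem1 := mem_base_gal_fixed hgal hsigma.
split=> [hM z /(num_range_hermitian sK hM) zz|hM]; first by rewrite mem1 zz.
have {}hM z : num_range sigma M z -> sigma z = z.
  by move/hM; rewrite mem1 => /eqP.
have sA k : sigma k%:A = k%:A :> L by apply/eqP; rewrite -mem1 rpredZ ?rpred1.
have sq_neq0 k : (k ^+ 2)%:A <> 0 :> L -> k%:A != 0 :> L.
  by move=> k2; apply/eqP => k0; apply: k2; rewrite expr2 -scalerA k0 scaler0.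
have sqA k : (k ^+ 2)%:A = k%:A ^+ 2 :> L by rewrite exprZn expr1n.
case: hK => [char0|[_ [w [d [_ [[d0 d1] [wK [ww [[h dh] [k dk]]]]]]]]]].
(* [L] inherits characteristic 0 from [K], so 2 and 5 are invertible in [L]. *)
- have nat0 m : m.+1%:R != 0 :> L.
    have /pcharf0P-> // : [pchar L] =i pred0.
    by move=> p; rewrite (pchar_lalg L).
  have [t st] : exists t : L, sigma t != t.
    have /subvPn[t _] : ~~ ({:L} <= 1)%VS.
      by apply/negP => /dimvS; rewrite dimv1 hdeg.
    by rewrite mem1; exists t.
  have [w ww sw] := exists_norm1_not_fixed sK (nat0 1) st.
  have s35 (m : nat) : sigma (m%:R / 5%:R) = m%:R / 5%:R.
    by rewrite fmorph_div !rmorph_nat.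
  have n5 m : m.+1%:R / 5%:R != 0 :> L by rewrite mulf_neq0 ?invr_eq0 ?nat0.
  apply: (hermitian_num_range sK (s35 3%N) (s35 4%N) (n5 2) (n5 3) _ _ _ hM
           (w := 3%:R / 5%:R * w)).
  + by field; apply: nat0.
  + by rewrite rmorphM /= s35 mulrACA ww mulr1 expr2.
  + by rewrite rmorphM /= s35 (inj_eq (mulfI (n5 2))).
(* The square roots of [d] and [1 - d] serve as the pair; they are nonzero because [d] is neither 0
   nor 1. *)
- have h0 : h%:A != 0 :> L by apply: sq_neq0; rewrite -dh.
  have k0 : k%:A != 0 :> L.
    by apply: sq_neq0; rewrite -dk => /eqP; rewrite subr_eq0 => /eqP/esym.
  apply: (hermitian_num_range sK (sA h) (sA k) h0 k0 _ _ _ hM (w := w)).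
  + by rewrite -!sqA -dh -dk addrC subrK.
  + by rewrite ww dh sqA.
  + by rewrite -mem1.
Qed.
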